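(* Let $n\ge 4$ and $1\le p\le n-3$ be integers, let $a$ be a real number with $a>1$ or $0<a\le e^{-1}$, and let $m=\lfloor \frac{2n-p}{n-p}\rfloor$ and $t=2n-p-m(n-p)$. Then for every unicyclic graph $G$ with $n$ vertices and exactly $p$ pendant vertices, $$ t(m+1)a^{m+1} + (n-p-t)\, m\, a^{m} + p a \le SEI_a(G) \le (p+2)a^{p+2} + (n-p-1)\,2a^2 + p a, $$ and both inequalities are attained (i.e., for each such $n,p,a$, each of the two bounds is equal to $SEI_a(G)$ for some unicyclic graph $G$ with $n$ vertices and $p$ pendant vertices).
   Context: All graphs are finite, connected, simple (no loops, no multiple edges) and have at least one edge. A unicyclic graph is a graph containing exactly one cycle. A vertex is pendant if it has degree $1$. For a vertex $u$ of $G$, $d_u$ denotes its degree. For a positive real number $a\ne 1$, the variable sum exdeg index is $SEI_a(G)=\sum_{uv\in E(G)}(a^{d_u}+a^{d_v})=\sum_{u\in V(G)} d_u a^{d_u}$. *)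

(* Defs.v *)
From HB Require Import structures.
From mathcomp Require Import all_boot all_order all_algebra.
From mathcomp Require Import reals.

Set Implicit Arguments.
Unset Strict Implicit.
Unset Printing Implicit Defensive.

Import Order.TTheory GRing.Theory Num.Theory.

Record graph := Graph {
  vertex :> finType;
  adj : rel vertex;
  adj_sym : symmetric adj;
  adj_irrefl : irreflexive adj;
  adj_connected : forall x y, connect adj x y;
  adj_edge : exists x y, adj x y
}.

Definition edges (G : graph) : {set {set G}} :=
  [set [set e.1; e.2] | e : G * G & adj e.1 e.2].

Definition deg (G : graph) (u : G) : nat := #|[set v | adj u v]|.

Definition pendants (G : graph) : {set G} := [set u | deg u == 1].

(* A cycle is a subgraph, represented by its set of edges, so that the rotations
   and reversals of a cyclic sequence of vertices all give the same cycle. The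
   bound on the size is needed because [cycle adj] also holds for [:: x; y] when
   x and y are adjacent. *)
Definition is_cycle (G : graph) (C : {set {set G}}) : Prop :=
  exists c : seq G,
    [/\ 3 <= size c, ucycle (@adj G) c & C = [set [set x; next c x] | x in c]].

Definition unicyclic (G : graph) : Prop :=
  exists! C : {set {set G}}, is_cycle C.

Definition SEI (R : realType) (a : R) (G : graph) : R :=
  (\sum_(E in edges G) \sum_(u in E) a ^+ deg u)%R.

Definition unicyclic_np (n p : nat) (G : graph) : Prop :=
  [/\ unicyclic G, #|G| = n & #|pendants G| = p].

(* Main.v *)
Require Import Defs.
From HB Require Import structures.
From mathcomp Require Import all_boot all_order all_algebra.
From mathcomp Require Import zify ring lra.
From mathcomp Require Import reals sequences exp.

Set Implicit Arguments.
Unset Strict Implicit.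
Unset Printing Implicit Defensive.

Import Order.TTheory GRing.Theory Num.Theory.

(* Write f(d) = d a^d, so that SEI_a(G) is the sum of f over the degrees.  For the
   given a, f is convex on the integers d >= 2, though not from d = 1 on when
   a <= 1/e, so pendant vertices are kept apart.  A connected graph with a single
   cycle has degree sum 2n: deleting an edge of the cycle leaves a connected graph
   without cycles.  Hence the n-p non-pendant vertices have excesses deg - 2 >= 0
   of total p.  Superadditivity of the convex function x |-> f(x+2) - f(2) gives the
   upper bound (all the excess on one vertex), and the supporting line at m, m+1 the
   lower bound (the excess spread evenly).  Both extremal distributions are
   realized by a cycle of length n-p with pendant vertices attached to it. *)

(** * Edge counts and cycles *)

Section Arcs.
Variables (T : finType) (e : rel T).
Hypotheses (e_sym : symmetric e) (e_irr : irreflexive e).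

(** Ordered pairs: each edge inside [S] counts once per orientation, so degree sums are
    cardinalities and nothing has to be halved. *)
Definition arcs_in (S : {set T}) : {set T * T} :=
  [set u | [&& u.1 \in S, u.2 \in S & e u.1 u.2]].

(** A set grown from [r] one vertex at a time along an edge leaving it gains both orientations of
    that edge; connectedness supplies such an edge until all of [T] is reached. *)
Lemma arcs_in_connected (r : T) :
  (forall x y, connect e x y) -> 2 * #|T|.-1 <= #|arcs_in setT|.
Proof.
move=> e_conn.
suff grow k : k < #|T| -> exists2 S : {set T}, #|S| = k.+1 & 2 * k <= #|arcs_in S|.
  have T0 : 0 < #|T| by apply/card_gt0P; exists r.
  have [|S cS hS] := grow #|T|.-1; first by rewrite prednK.
  apply: leq_trans hS _; apply/subset_leq_card/subsetP => u.
  by rewrite !inE => /and3P[].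
elim: k => [|k IH] hk; first by exists [set r]; rewrite ?cards1.
have [S cS hS] := IH (ltnW hk).
have /existsP[u /existsP[v /and3P[uS vS euv]]] :
    [exists u, exists v, [&& u \in S, v \notin S & e u v]].
  apply/contraT => /existsPn noexit.
  have [x xS] : exists x, x \in S by apply/card_gt0P; rewrite cS.
  have clS : closed e (mem S).
    apply: intro_closed; first exact: sym_connect_sym.
    move=> u v euv uS; apply/contraT => vS.
    by have /existsPn/(_ v) := noexit u; rewrite [u \in S]uS vS euv.
  suff /eqP : #|S| = #|T| by rewrite cS ltn_eqF.
  by rewrite -cardsT; congr #|pred_of_set _|; apply/setP=> y;
     rewrite inE -(closed_connect clS (e_conn x y)).
exists (v |: S); first by rewrite cardsU1 vS cS.
have -> : 2 * k.+1 = 2 * k + 2 by lia.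
have uv : u != v by apply: contraNneq vS => <-.
have cuv : #|[set (u, v); (v, u)]| = 2 by rewrite cards2 xpair_eqE negb_and uv.
apply: leq_trans (leq_add hS (eq_leq (esym cuv))) _.
rewrite -cardsUI [X in _ + X](_ : _ = 0) ?addn0; last first.
  apply/eqP; rewrite cards_eq0 -subset0; apply/subsetP => -[x y].
  by rewrite !inE !xpair_eqE /=;
     case/andP => /and3P[xS yS _] /orP[] /andP[/eqP ? /eqP ?]; subst; rewrite ?xS ?yS in vS.
apply/subset_leq_card/subsetP => -[x y].
rewrite !inE !xpair_eqE /=; case/orP=> [/and3P[-> -> ->]|]; first by rewrite !orbT.
by case/orP=> /andP[/eqP -> /eqP ->]; rewrite ?uS ?eqxx ?orbT //= e_sym.
Qed.

(* A simple path that cannot be prolonged at its head x closes up: x has a neighbour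
   other than the next vertex of the path, which must lie further along it. *)
Lemma min_deg2_cycle (S : {set T}) (r : T) : r \in S ->
  (forall v, v \in S -> 1 < #|[set w in S | e v w]|) ->
  exists2 c, 3 <= size c & ucycle e c.
Proof.
move=> rS hdeg.
suff grow k : (exists2 c, 3 <= size c & ucycle e c) \/
    exists x s, [/\ x \in S, path e x s, uniq (x :: s) & size s = k].
  have [//|[x [s [_ _ us ss]]]] := grow #|T|.
  have := card_uniqP us; rewrite /= ss => h.
  by have := max_card (mem (x :: s)); rewrite h ltnn.
elim: k => [|k [|[x [s [xS ps us ss]]]]]; [|by left|].
  by right; exists r, [::].
(* For empty [s] the default [x] is excluded, which costs nothing since [x] is not its own
   neighbour. *)
have [y] : exists y, y \in [set w in S | e x w] :\ head x s.
  apply/card_gt0P; rewrite -ltnS; apply: leq_trans (hdeg x xS) _.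
  by rewrite (cardsD1 (head x s)); case: (_ \in _).
rewrite !inE => /and3P[ys yS exy].
have [yin|yin] := boolP (y \in s); last first.
  right; exists y, (x :: s); rewrite /= e_sym exy ps ss yS; split=> //.
  rewrite inE (negPf yin) orbF -/(uniq (x :: s)) us andbT.
  by apply: contraTneq exy => ->; rewrite e_irr.
left; case/splitPr: yin ps us ys ss => s1 s2.
rewrite cat_path /= => /and3P[ps1 elast ps2].
rewrite cat_uniq mem_cat /= !inE !negb_or.
case/and5P => /and3P[xs1 xy _] us1 /andP[ys1 _] _ _ yhd ss.
(* Since [y] is not the head of the old tail, [s1] is nonempty and the cycle has at least three
   vertices. *)
exists (x :: rcons s1 y).
  rewrite /= size_rcons; case: s1 yhd {ps1 elast xs1 us1 ys1 ss} => [|? ?] //=.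
  by rewrite eqxx.
rewrite /ucycle /= rcons_path rcons_path last_rcons ps1 elast e_sym exy /=.
by rewrite mem_rcons inE negb_or xy xs1 rcons_uniq ys1 us1.
Qed.

(** The hypothesis says that [S] spans at least as many edges as vertices. Removing a vertex with at
    most one neighbour in [S] preserves this; once no such vertex is left, [min_deg2_cycle]
    applies. *)
Lemma arcs_in_cycle (S : {set T}) : S != set0 -> 2 * #|S| < #|arcs_in S| + 2 ->
  exists2 c, 3 <= size c & ucycle e c.
Proof.
have [k] := ubnP #|S|; elim: k S => // k IH S hk S0 hS.
have [r rS] : exists r, r \in S by apply/set0Pn.
have [hdeg|] := boolP [forall (v | v \in S), 1 < #|[set w in S | e v w]|].
  by apply: (min_deg2_cycle rS) => v vS; have /forall_inP/(_ v vS) := hdeg.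
rewrite negb_forall_in => /exists_inP[v vS]; rewrite -leqNgt.
have cS : #|S| = #|S :\ v|.+1 by rewrite (cardsD1 v) vS.
set N := [set w in S | e v w] => hv.
have split_arcs : #|arcs_in S| <= #|arcs_in (S :\ v)| + 2 * #|N|.
  rewrite mul2n -addnn.
  rewrite -{1}(card_imset (mem N) (f := pair v)); last by move=> ? ? [].
  rewrite -(card_imset (mem N) (f := pair^~ v)); last by move=> ? ? [].
  apply: leq_trans (leq_add (leqnn _) (leq_card_setU _ _)).
  apply: leq_trans (leq_card_setU _ _); apply/subset_leq_card/subsetP => -[x y].
  rewrite !inE /= => /and3P[xS yS exy].
  have [xv|xv] := eqVneq x v.
    apply/orP; right; apply/orP; left; apply/imsetP; exists y; last by rewrite xv.
    by rewrite !inE yS -xv.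
  have [yv|yv] := eqVneq y v.
    apply/orP; right; apply/orP; right; apply/imsetP; exists x; last by rewrite yv.
    by rewrite !inE xS -yv e_sym.
  by rewrite xS yS exy.
apply: (IH (S :\ v)); [by lia| |by lia].
apply: contraTneq hS => Sv0; rewrite cS Sv0 cards0.
suff -> : #|arcs_in S| = 0 by [].
apply/eqP; rewrite cards_eq0 -subset0; apply/subsetP => -[x y].
have onlyv z : z \in S -> z = v.
  by move=> zS; apply/eqP; move/setP/(_ z): Sv0; rewrite !inE zS andbT => /negbFE.
by rewrite !inE /= => /and3P[/onlyv-> /onlyv->]; rewrite e_irr.
Qed.
End Arcs.

(** * Deleting an edge of a cycle *)

Section DeleteEdge.
Variables (T : finType) (e : rel T).
Hypotheses (e_sym : symmetric e) (e_irr : irreflexive e).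

Definition del_edge (E : {set T}) : rel T :=
  fun u v => e u v && ([set u; v] != E).
Arguments del_edge E u v /.

Lemma del_edge_sym E : symmetric (del_edge E).
Proof. by move=> u v; rewrite /= e_sym setUC. Qed.

Lemma del_edge_irr E : irreflexive (del_edge E).
Proof. by move=> u; rewrite /= e_irr. Qed.

Lemma card_arcs_del_edge x y : e x y ->
  #|arcs_in e setT| = #|arcs_in (del_edge [set x; y]) setT| + 2.
Proof.
move=> exy; have xy : x != y by apply: contraTneq exy => ->; rewrite e_irr.
pose D := [set (x, y); (y, x)].
have <- : #|D| = 2 by rewrite cards2 xpair_eqE negb_and xy.
have DE u v : ((u, v) \in D) = ([set u; v] == [set x; y]).
  rewrite !inE !xpair_eqE; apply/idP/eqP => [|uv].
    by case/orP => /andP[/eqP -> /eqP ->] //; rewrite setUC.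
  have : u \in [set x; y] by rewrite -uv set21.
  have : v \in [set x; y] by rewrite -uv set22.
  have : x \in [set u; v] by rewrite uv set21.
  have : y \in [set u; v] by rewrite uv set22.
  rewrite !inE.
  move=> /orP[] /eqP yE /orP[] /eqP xE _ _.
  - by rewrite yE xE eqxx in xy.
  - by rewrite yE xE !eqxx orbT.
  - by rewrite yE xE !eqxx.
  - by rewrite yE xE eqxx in xy.
rewrite -(cardsID D (arcs_in e setT)) addnC; congr (_ + _).
  by apply: eq_card => -[u v]; rewrite !in_setD DE !inE /= andbC.
apply: eq_card => -[u v]; rewrite in_setI andbC.
case: (boolP (_ \in D)) => //=; rewrite !inE !xpair_eqE /=.
by case/orP => /andP[/eqP -> /eqP ->]; rewrite ?exy // e_sym.
Qed.

(** The rest of the cycle still joins [y] to [x], so every use of the deleted edge can be rerouted.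
    A nonempty [s] rules out the edge run back and forth. *)
Lemma connect_del_edge x y s : s != [::] -> ucycle e [:: x, y & s] ->
  (forall u v, connect e u v) -> forall u v, connect (del_edge [set x; y]) u v.
Proof.
move=> s0 /andP[/= /andP[exy pys] /and3P[]].
rewrite inE negb_or => /andP[xy xs] ys us e_conn.
set e' := del_edge _.
have step u v : e u v -> (u \notin [set x; y]) || (v \notin [set x; y]) -> e' u v.
  move=> euv /orP[h|h]; rewrite /e' /= euv /=; apply: contra h => /eqP <-;
  by rewrite !inE eqxx ?orbT.
have yx : connect e' y x.
  apply/connectP; exists (rcons s x); last by rewrite last_rcons.
  case: s s0 pys xs ys us => // z s _ /= /andP[eyz] pzs.
  rewrite inE negb_or => /andP[xz xs]; rewrite inE negb_or => /andP[yz ys] _.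
  rewrite step ?eyz //=; last by rewrite !inE !negb_or ![z == _]eq_sym xz yz orbT.
  (* The vertices strictly between [y] and [x] avoid both, so each step of this path has an end off
     the deleted edge. *)
  have {xs ys} : all (mem (~: [set x; y])) (z :: s).
    rewrite /= !inE !negb_or ![z == _]eq_sym xz yz /=.
    by apply/allP => w ws; rewrite !inE negb_or; apply/andP; split;
       [apply: contraNneq xs|apply: contraNneq ys] => <-.
  elim: s z pzs {eyz xz yz} => /= [|w s IH] z.
    by rewrite andbT => ezx /andP[hz _]; rewrite step //; move: hz; rewrite inE => ->.
  case/andP=> ezw pws /and3P[hz hw hs].
  by rewrite step ?IH //= ?hw //; move: hz; rewrite inE => ->.
have e'sym := sym_connect_sym (del_edge_sym [set x; y]).
move=> u v; apply: connect_sub (e_conn u v) => {}u {}v euv.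
have [uv|] := boolP ([set u; v] == [set x; y]); last first.
  by move=> uv; apply: connect1; rewrite /e' /= euv.
have : u \in [set x; y] by rewrite -(eqP uv) set21.
have : v \in [set x; y] by rewrite -(eqP uv) set22.
by rewrite !inE => /orP[] /eqP -> /orP[] /eqP ->; rewrite ?connect0 // e'sym.
Qed.

End DeleteEdge.

(** * Degree sums of graphs *)

Lemma sum_card_arcs (G : graph) : \sum_(u : G) deg u = #|arcs_in (@adj G) setT|.
Proof.
rewrite -sum1_card (eq_bigl (fun u => true && adj u.1 u.2)); last first.
  by move=> u; rewrite !inE.
rewrite -(pair_big_dep xpredT (fun u v : G => adj u v) (fun _ _ => 1)) /=.
by apply: eq_bigr => u _; rewrite sum1_card /deg cardsE.
Qed.

(** Deleting an edge [E] of the cycle keeps the graph connected, which bounds the arcs from below.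
    With more arcs, [arcs_in_cycle] would find a cycle avoiding [E], hence a second cycle of [G]. *)
Lemma unicyclic_sum_deg (G : graph) : unicyclic G -> \sum_(u : G) deg u = 2 * #|G|.
Proof.
case=> C [[c [sc uc Cc]] Cuniq]; rewrite sum_card_arcs.
have sym := @adj_sym G; have irr := @adj_irrefl G.
case: c sc uc Cc => [|x [|y [|z s]]] // _ uc Cc.
have exy : adj x y by case/andP: uc => /andP[].
set E := [set x; y].
have EC : E \in C by rewrite Cc; apply/imsetP; exists x; rewrite ?mem_head //= eqxx.
have arcsE := card_arcs_del_edge sym irr exy.
have lo : 2 * #|G|.-1 <= #|arcs_in (del_edge (@adj G) E) setT|.
  apply: (arcs_in_connected _ x); first exact: del_edge_sym.
  by apply: connect_del_edge uc _ => //; apply: adj_connected.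
have G0 : 0 < #|G| by apply/card_gt0P; exists x.
apply/eqP; rewrite eqn_leq; apply/andP; split; last first.
  have nat_bound A B k : 0 < k -> A = B + 2 -> 2 * k.-1 <= B -> 2 * k <= A by lia.
  exact: nat_bound G0 arcsE lo.
rewrite leqNgt; apply/negP => hi.
have [||||c sc uc'] := @arcs_in_cycle _ (del_edge (@adj G) E) _ _ setT.
- exact: del_edge_sym.
- exact: del_edge_irr.
- by rewrite -card_gt0 cardsT.
- by rewrite cardsT -arcsE.
case/andP: uc' => cc' uc'.
have : C = [set [set u; next c u] | u in c].
  apply: Cuniq; exists c; split=> //; apply/andP; split=> //.
  by apply: sub_cycle cc' => u v /andP[].
move=> CE; move: EC; rewrite CE => /imsetP[u uin Eu].
by have /andP[_] := next_cycle cc' uin; rewrite -Eu /E eqxx.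
Qed.

(** After exchanging the sums, [a ^+ deg u] occurs once per edge through [u], and these edges
    correspond to the neighbours of [u]. *)
Lemma SEI_sum_deg (R : realType) (a : R) (G : graph) :
  SEI a G = (\sum_(u : G) (deg u)%:R * a ^+ deg u)%R.
Proof.
rewrite /SEI (exchange_big_dep predT) //=; apply: eq_bigr => u _.
rewrite sumr_const mulr_natl; congr (_ *+ _)%R.
rewrite /deg -(card_in_imset (f := fun v => [set u; v])); last first.
  move=> v w; rewrite !inE => uv uw eq_vw.
  have : v \in [set u; w] by rewrite -eq_vw set22.
  rewrite !inE => /orP[/eqP vu|/eqP //].
  by rewrite vu adj_irrefl in uv.
apply: eq_card => E; apply/andP/imsetP => [[/imsetP[[v w]] /=]|[v]].
  rewrite inE /= => vw -> ; rewrite !inE => /orP[] /eqP ->; first by exists w; rewrite ?inE.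
  by exists v; rewrite ?inE 1?adj_sym // setUC.
rewrite inE => uv ->; split; last by rewrite set21.
by apply/imsetP; exists (u, v); rewrite ?inE.
Qed.

(** * Convex sequences *)

Section ConvexSequence.
Local Open Scope ring_scope.
Variables (R : realFieldType) (g : nat -> R).
Hypothesis g_convex : forall k, g k.+1 - g k <= g k.+2 - g k.+1.

Lemma convex_slope_le i j : (i <= j)%N -> g i.+1 - g i <= g j.+1 - g j.
Proof.
move=> ij; rewrite -(subnK ij); elim: (j - i)%N => // k IH.
exact: le_trans IH (g_convex _).
Qed.

(** The line through the values at [m] and [m.+1] stays below [g]: increments from [m] on are at
    least its slope, earlier ones at most. *)
Lemma convex_support m d :
  g m + (d%:R - m%:R) * (g m.+1 - g m) <= g d.
Proof.
have [md|/ltnW dm] := leqP m d.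
  rewrite -(subnK md); elim: (d - m)%N => [|k IH]; first by rewrite subrr mul0r addr0.
  have := convex_slope_le (leq_addl k m); rewrite addSn -[(_ + _).+1]addn1 !natrD in IH *.
  by rewrite addn1; lra.
(* Here [d] is fixed and the support point moves away from it; its growing slope meets the
   nonpositive factor [d - m]. *)
rewrite -(subnK dm); elim: (m - d)%N => [|k IH]; first by rewrite subrr mul0r addr0.
have k0 : 0 <= k%:R :> R by [].
have := convex_slope_le (leqnSn (k + d)); rewrite addSn -[(k + d).+1%:R]natr1.
by move=> slope; have := ler_wpM2l k0 slope; move: IH slope; rewrite natrD; lra.
Qed.

Lemma convex_superadditive x y : g x + g y <= g (x + y)%N + g 0.
Proof.
elim: y => [|y IH]; first by rewrite addn0.
by have := convex_slope_le (leq_addl x y); rewrite addnS; lra.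
Qed.

Variables (I : finType) (A : {set I}) (x : I -> nat).

(** Superadditivity of [g - g 0], which vanishes at 0, iterated over [A]. *)
Lemma convex_sum_le :
  \sum_(i in A) g (x i) <= g (\sum_(i in A) x i)%N + (#|A|%:R - 1) * g 0.
Proof.
rewrite mulrBl mul1r addrCA mulr_natl -sumr_const -lerBlDl -sumrB.
apply: (big_ind2 (fun s t => s <= g t - g 0)) => [|s t s' t' h h'|i _] //.
  by rewrite subrr.
by have := convex_superadditive t t'; lra.
Qed.

(** The support lines at [q] add up to [k g(q) + r (g(q+1) - g(q))]. *)
Lemma convex_sum_ge (k q r : nat) : k = #|A| -> (r <= k)%N ->
  (\sum_(i in A) x i = q * k + r)%N ->
  r%:R * g q.+1 + (k - r)%:R * g q <= \sum_(i in A) g (x i).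
Proof.
move=> kA rk sx.
apply: le_trans (ler_sum _ (fun i _ => convex_support q (x i))).
rewrite big_split sumr_const -kA -mulr_suml sumrB sumr_const -kA -natr_sum sx /=.
by rewrite natrB // -(mulr_natl (g q)) -(mulr_natl q%:R) natrD natrM; lra.
Qed.

End ConvexSequence.

(** Indexed by the excess of the degree over 2, so that convexity holds from index 0 on. *)
Definition exdeg_term (R : realType) (a : R) (k : nat) : R := ((k + 2)%:R * a ^+ (k + 2))%R.

Lemma exdeg_term_convex (R : realType) (a : R) :
  (1 < a \/ (0 < a /\ a <= expR (-1)))%R ->
  forall k, (exdeg_term a k.+1 - exdeg_term a k <=
             exdeg_term a k.+2 - exdeg_term a k.+1)%R.
Proof.
move=> ha k; rewrite -subr_ge0 /exdeg_term.
have -> : (k.+2 + 2 = k.+4)%N by lia.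
have -> : (k.+1 + 2 = k.+3)%N by lia.
have -> : (k + 2 = k.+2)%N by lia.
(* The second difference factors: (d+2)a^2 - 2(d+1)a + d = (a-1)((d+2)a - d), d = k+2. *)
have -> : (k.+4%:R * a ^+ k.+4 - k.+3%:R * a ^+ k.+3
     - (k.+3%:R * a ^+ k.+3 - k.+2%:R * a ^+ k.+2)
   = a ^+ k.+2 * ((a - 1) * ((k%:R + 4) * a - (k%:R + 2))))%R.
  by rewrite -[k.+4]addn4 -[k.+3]addn3 -[k.+2]addn2 !natrD !exprD; ring.
have k0 : (0 <= k%:R :> R)%R by [].
have a0 : (0 < a)%R by case: ha => [|[]//]; apply: lt_trans.
apply: mulr_ge0; first by rewrite exprn_ge0 // ltW.
case: ha => [a1|[_ ae]].
  have /(mulr_ge0 k0) h : (0 <= a - 1)%R by lra.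
  by apply: mulr_ge0; lra.
(* For [a <= 1/2] both factors are nonpositive, [k = 0] being the tightest case; the bound follows
   from [e >= 2]. *)
suff a2 : (a <= 2^-1)%R.
  have /(mulr_ge0 k0) h : (0 <= 2^-1 - a)%R by lra.
  by apply: mulr_le0; lra.
apply: le_trans ae _; rewrite expRN lef_pV2 ?posrE ?expR_gt0 //.
by have := expR_ge1Dx (1 : R)%R; lra.
Qed.

(** * Degrees in unicyclic graphs *)

Section Bounds.
Variables (R : realType) (a : R) (n p : nat) (G : graph).
Hypotheses (ha : (1 < a \/ (0 < a /\ a <= expR (-1)))%R).
Hypothesis (hG : unicyclic_np n p G).

Lemma deg_gt0 (u : G) : 0 < deg u.
Proof.
have [x [y xy]] := adj_edge G.
have [w uw] : exists w, u != w.
  have [ux|] := eqVneq u x; last by exists x.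
  by exists y; rewrite ux; apply: contraTneq xy => ->; rewrite adj_irrefl.
have /connectP[[|v s] /=] := adj_connected u w; first by move=> _ wu; rewrite wu eqxx in uw.
by case/andP => uv _ _; apply/card_gt0P; exists v; rewrite inE.
Qed.

(** No degree is 0, so truncated subtraction loses nothing off the pendant vertices. *)
Lemma nonpendant_deg (u : G) : u \in ~: pendants G -> deg u - 2 + 2 = deg u.
Proof. by rewrite !inE => h; rewrite subnK //; have := deg_gt0 u; lia. Qed.

Lemma card_nonpendant : #|~: pendants G| = n - p.
Proof. by case: hG => _ <- <-; rewrite cardsCs setCK. Qed.

(** The degree sum reads [2n = p + 2(n - p) + total excess]. *)
Lemma sum_excess_deg : \sum_(u in ~: pendants G) (deg u - 2) = p.
Proof.
case: hG => uG nG pG; have := unicyclic_sum_deg uG.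
rewrite (bigID (fun u => u \in pendants G)) /= nG.
rewrite (eq_bigr (fun _ => 1)) => [|u]; last by rewrite inE => /eqP.
rewrite sum1_card pG (eq_bigl (fun u => u \in ~: pendants G)); last first.
  by move=> u; rewrite in_setC.
have -> : \sum_(u in ~: pendants G) deg u = \sum_(u in ~: pendants G) (deg u - 2 + 2).
  by apply: eq_bigr => u /nonpendant_deg.
rewrite big_split sum_nat_const /= card_nonpendant.
have : p <= n by rewrite -nG -pG max_card.
lia.
Qed.

Lemma SEI_nonpendant :
  SEI a G = (\sum_(u in ~: pendants G) exdeg_term a (deg u - 2) + p%:R * a)%R.
Proof.
rewrite SEI_sum_deg (bigID (fun u => u \in pendants G)) /= addrC.
case: hG => _ _ pG; congr (_ + _)%R.
  apply: eq_big => [u|u]; rewrite ?in_setC // => uA.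
  by rewrite /exdeg_term nonpendant_deg // in_setC.
rewrite (eq_bigr (fun _ => a)) => [|u]; last by rewrite inE => /eqP ->; rewrite mul1r.
by rewrite sumr_const pG mulr_natl.
Qed.

Lemma SEI_le :
  (SEI a G <= exdeg_term a p + ((n - p)%:R - 1) * exdeg_term a 0 + p%:R * a)%R.
Proof.
rewrite SEI_nonpendant lerD2r.
have := convex_sum_le (exdeg_term_convex ha) (~: pendants G) (fun u => deg u - 2).
by rewrite sum_excess_deg card_nonpendant.
Qed.

Lemma SEI_ge q r : r <= n - p -> p = q * (n - p) + r ->
  (r%:R * exdeg_term a q.+1 + (n - p - r)%:R * exdeg_term a q + p%:R * a <= SEI a G)%R.
Proof.
move=> rk pE; rewrite SEI_nonpendant lerD2r.
apply: (convex_sum_ge (exdeg_term_convex ha)) => //; first by rewrite card_nonpendant.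
by rewrite sum_excess_deg.
Qed.

End Bounds.

(** * Cycles with pendant vertices attached *)

Lemma iter_ordS k (i : 'I_k) d : val (iter d (@ordS k) i) = (i + d) %% k.
Proof.
elim: d => [|d IH]; first by rewrite addn0 modn_small.
by rewrite iterS [LHS]/= IH -addn1 modnDml addn1 addnS.
Qed.

Lemma ordS_ind k (P : 'I_k -> Prop) i0 :
  P i0 -> (forall i, P i -> P (ordS i)) -> forall j, P j.
Proof.
move=> P0 PS j.
(* Adding a full turn [k] avoids a truncated [j - i0]. *)
have -> : j = iter (k - i0 + j) (@ordS k) i0.
  apply: val_inj; rewrite iter_ordS addnA subnKC ?(ltnW (ltn_ord _)) //.
  by rewrite modnDl modn_small.
by elim: (_ + _) => // d IH; apply: PS.
Qed.

Lemma ordS_neq k (i : 'I_k) : 1 < k -> ordS i != i.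
Proof.
move=> hk; rewrite -val_eqE -[val (ordS i)]/(i.+1 %% k).
have := ltn_ord i; rewrite leq_eqVlt => /orP[/eqP ik|ik]; last by rewrite modn_small //=; lia.
by rewrite ik modnn /=; lia.
Qed.

Lemma ordSS_neq k (i : 'I_k) : 2 < k -> ordS (ordS i) != i.
Proof.
move=> hk; rewrite -val_eqE -[val (ordS (ordS i))]/(val (iter 2 (@ordS k) i)) iter_ordS.
have ik := ltn_ord i; have [h|h] := ltnP (i + 2) k; first by rewrite modn_small //=; lia.
by rewrite -(subnK h) modnDr modn_small /=; lia.
Qed.

Lemma next_neq_prev (T : eqType) (c : seq T) x :
  uniq c -> 3 <= size c -> x \in c -> next c x != prev c x.
Proof.
move=> uc sc xc; case: (rot_to xc) => i s cE.
rewrite -(next_rot i uc) -(prev_rot i uc) cE.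
move: uc sc; rewrite -(rot_uniq i) -(size_rot i c) cE.
case: s {cE} => [|y [|z s]] // /and3P[xs ys _] _.
(* As [x] is missing from the tail, its index there is the length of the tail, which is the position
   of the last entry of the whole list. *)
have -> : prev [:: x, y, z & s] x = last z s.
  rewrite prev_nth mem_head -[LHS]/(nth x [:: x, y, z & s] (index x [:: y, z & s])).
  by rewrite (memNindex xs) -[LHS]/(nth x (z :: s) (size s)) (nth_last x (z :: s)).
rewrite /= eqxx.
by apply: contraNneq ys => ->; apply: mem_last.
Qed.

Section Sun.
Variables (k : nat) (c : 'I_k -> nat).

(** The left summand is the rim, a cycle of length [k]; the right one holds the pendant vertices,
    each tagged with the rim vertex that carries it. *)
Definition sun_vertex : finType := ('I_k + {i : 'I_k & 'I_(c i)})%type.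

Definition sun_adj : rel sun_vertex := fun u v =>
  match u, v with
  | inl i, inl j => (j == ordS i) || (i == ordS j)
  | inl i, inr w => tag w == i
  | inr w, inl i => tag w == i
  | inr _, inr _ => false
  end.

Hypothesis k_ge3 : 2 < k.
Let k_gt0 : 0 < k := ltnW (ltnW k_ge3).
Let i0 : 'I_k := Ordinal k_gt0.

Lemma sun_adj_sym : symmetric sun_adj.
Proof. by case=> [i|w] [j|w'] //=; rewrite orbC. Qed.

Lemma sun_adj_irrefl : irreflexive sun_adj.
Proof. by case=> [i|w] //=; rewrite orbb eq_sym (negPf (ordS_neq _ (ltnW k_ge3))). Qed.

Lemma sun_adj_connected u v : connect sun_adj u v.
Proof.
have conn_sym := sym_connect_sym sun_adj_sym.
suff h w : connect sun_adj (inl i0) w by apply: connect_trans (h v); rewrite conn_sym.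
have rim i : connect sun_adj (inl i0) (inl i).
  move: i; apply: (ordS_ind (i0 := i0)); first exact: connect0.
  by move=> i h; apply: connect_trans h (connect1 _); rewrite /= eqxx.
case: w => [//|w]; apply: connect_trans (rim (tag w)) (connect1 _).
by rewrite /= eqxx.
Qed.

Lemma sun_adj_edge : exists u v, sun_adj u v.
Proof. by exists (inl i0), (inl (ordS i0)); rewrite /= eqxx. Qed.

Definition sun : graph :=
  Graph sun_adj_sym sun_adj_irrefl sun_adj_connected sun_adj_edge.

Lemma deg_sun_rim i : @deg sun (inl i) = c i + 2.
Proof.
rewrite /deg.
have -> : [set v : sun | @adj sun (inl i) v] =
    [set inr (Tagged (fun i => 'I_(c i)) w) | w in 'I_(c i)]
    :|: [set inl (ordS i); inl (ord_pred i)].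
  apply/setP => -[j|w]; rewrite !inE /=.
    have -> /= : (inl j \in [set inr (Tagged (fun i => 'I_(c i)) w) | w in 'I_(c i)]) = false.
      by apply/negP => /imsetP[].
    rewrite ?(inj_eq inl_inj) -(can_eq (@ordSK k) j (ord_pred i)) ord_predK.
    by rewrite [ordS j == i]eq_sym.
  rewrite !orbF; apply/eqP/imsetP => [wi|[x _ [->]] //].
  by case: w wi => j w /= ji; subst j; exists w.
rewrite cardsU disjoint_setI0 ?cards0 ?subn0.
  rewrite card_imset ?card_ord; last by move=> x y [] /eqP; rewrite eq_Tagged => /eqP.
  rewrite cards2 (inj_eq inl_inj) -(can_eq (@ordSK k)) ord_predK ordSS_neq //.
rewrite disjoint_subset; apply/subsetP => v /imsetP[w _ ->]; by rewrite !inE.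
Qed.

Lemma deg_sun_ray w : @deg sun (inr w) = 1.
Proof.
apply/eqP/cards1P; exists (inl (tag w)); apply/setP => -[i|w']; rewrite !inE //=.
by rewrite (inj_eq inl_inj) eq_sym.
Qed.

Lemma card_rays : #|{: {i : 'I_k & 'I_(c i)}}| = \sum_i c i.
Proof.
rewrite card_tagged sumnE big_map big_enum.
by apply: eq_bigr => i _; rewrite card_ord.
Qed.

Lemma card_sun : #|sun| = k + \sum_i c i.
Proof. by rewrite card_sum card_ord card_rays. Qed.

Lemma card_pendants_sun : #|pendants sun| = \sum_i c i.
Proof.
rewrite -card_rays -(card_imset predT (@inr_inj 'I_k _)); apply: eq_card => -[i|w].
  rewrite inE deg_sun_rim addn2; apply/esym/negP => /imsetP[] //.
by rewrite inE deg_sun_ray eqxx; apply/esym/imsetP; exists w.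
Qed.

(** A vertex on a cycle has two distinct neighbours there, which excludes pendant vertices. At a rim
    vertex these are both of its rim neighbours, so the cycle runs through the whole rim. *)
Lemma is_cycle_sun (C : {set {set sun}}) : is_cycle C ->
  C = [set [set (inl i : sun); inl (ordS i)] | i : 'I_k].
Proof.
case=> s [ss /andP[cs us] ->].
have on_rim v : v \in s -> exists i, v = inl i.
  case: v => [i|w] vs; first by exists i.
  have : 1 < @deg sun (inr w).
    apply: (@leq_trans #|[set next s (inr w); prev s (inr w)]|).
      by rewrite cards2 next_neq_prev.
    apply/subset_leq_card/subsetP => v; rewrite !inE => /orP[] /eqP ->.
      exact: next_cycle.
    by rewrite adj_sym; apply: prev_cycle.
  by rewrite deg_sun_ray.
have succ i : inl i \in s -> next s (inl i) = inl (ordS i) \/ prev s (inl i) = inl (ordS i).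
  move=> si; have := next_cycle cs si; have := prev_cycle cs si.
  have := next_neq_prev us ss si.
  have /on_rim[j ->] : next s (inl i) \in s by rewrite mem_next.
  have /on_rim[j' ->] : prev s (inl i) \in s by rewrite mem_prev.
  move=> jj' /= /orP[/eqP ij'|/eqP ->]; last by right.
  case/orP=> /eqP ij; first by left; rewrite ij.
  by rewrite ij in ij'; rewrite (can_inj (@ordSK k) ij') eqxx in jj'.
have rim_in : forall i, inl i \in s.
  case: s ss us on_rim succ cs => // v s' _ us on_rim succ _.
  have [j vj] := on_rim v (mem_head _ _).
  apply: (ordS_ind (i0 := j)); first by rewrite -vj mem_head.
  by move=> i si; case: (succ i si) => <-; rewrite ?mem_next ?mem_prev.
apply/setP => E; apply/imsetP/imsetP => [[v vs ->]|[i _ ->]].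
  have [i vi] := on_rim v vs; subst v; have := next_cycle cs vs.
  have /on_rim[j ->] : next s (inl i) \in s by rewrite mem_next.
  rewrite /= => /orP[/eqP->|/eqP->]; first by exists i.
  by exists j; rewrite // setUC.
(* The cycle may run round the rim either way; run backwards, it lists this edge at [ordS i]. *)
case: (succ i (rim_in i)) => nE; first by exists (inl i); rewrite ?rim_in ?nE.
by exists (inl (ordS i)); rewrite ?rim_in // -nE next_prev // setUC.
Qed.

(** Uniqueness is [is_cycle_sun]; existence comes from [min_deg2_cycle] on the rim, without writing
    the cycle as a sequence. *)
Lemma unicyclic_sun : unicyclic sun.
Proof.
suff [s s3 us] : exists2 s : seq sun, 3 <= size s & ucycle (@adj sun) s.
  have sC : is_cycle [set [set x; next s x] | x in s] by exists s.
  exists [set [set x; next s x] | x in s]; split=> // C /is_cycle_sun ->.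
  exact: is_cycle_sun.
pose S := [set v : sun | if v is inl _ then true else false].
apply: (@min_deg2_cycle _ _ sun_adj_sym sun_adj_irrefl S (inl i0)); first by rewrite inE.
case=> [i _|w]; last by rewrite inE.
apply: (@leq_trans #|[set (inl (ordS i) : sun); inl (ord_pred i)]|).
  rewrite cards2 (inj_eq inl_inj) -(can_eq (@ordSK k)) ord_predK.
  by rewrite ordSS_neq.
apply/subset_leq_card/subsetP => v; rewrite !inE.
by case/orP=> /eqP -> /=; rewrite ?eqxx // ord_predK eqxx orbT.
Qed.

Lemma sun_unicyclic_np : unicyclic_np (k + \sum_i c i) (\sum_i c i) sun.
Proof. by split; [exact: unicyclic_sun|exact: card_sun|exact: card_pendants_sun]. Qed.

Lemma SEI_sun (R : realType) (a : R) :
  SEI a sun = (\sum_i exdeg_term a (c i) + (\sum_i c i)%:R * a)%R.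
Proof.
rewrite SEI_sum_deg big_sumType /=; congr (_ + _)%R.
  by apply: eq_bigr => i _; rewrite deg_sun_rim.
rewrite (eq_bigr (fun _ => a)) => [|w _]; last by rewrite deg_sun_ray mul1r.
by rewrite sumr_const card_rays mulr_natl.
Qed.

End Sun.

(** * The two bounds and the graphs attaining them *)

Local Open Scope ring_scope.

Theorem theorem5p6 (R : realType) (n p : nat) (a : R)
  (hn : (4 <= n)%N) (hp1 : (1 <= p)%N) (hpn : (p <= n - 3)%N)
  (ha : 1 < a \/ (0 < a /\ a <= expR (-1))) :
  let m := ((2 * n - p) %/ (n - p))%N in
  let t := (2 * n - p - m * (n - p))%N in
  let lower := (t * m.+1)%:R * a ^+ m.+1 + ((n - p - t) * m)%:R * a ^+ m
               + p%:R * a in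
  let upper := (p + 2)%:R * a ^+ (p + 2) + (n - p - 1)%:R * (2 * a ^+ 2)
               + p%:R * a in
  [/\ forall G : graph, unicyclic_np n p G -> lower <= SEI a G <= upper,
      exists G : graph, unicyclic_np n p G /\ SEI a G = lower
    & exists G : graph, unicyclic_np n p G /\ SEI a G = upper].
Proof.
move=> m t lower upper.
have [k k3 nE] : exists2 k, (2 < k)%N & n = (k + p)%N.
  by exists (n - p)%N; lia.
have nkE : (n - p = k)%N by rewrite nE addnK.
(* Since [2n - p = 2k + p], the numbers [m - 2] and [t] are the quotient and remainder of [p] by
   [k]. *)
pose q := (p %/ k)%N; pose r := (p %% k)%N.
have pE : p = (q * k + r)%N by apply: divn_eq.
have rk : (r < k)%N by rewrite ltn_pmod //; lia.
have mE : m = q.+2.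
  rewrite /m nkE (_ : 2 * n - p = 2 * k + p)%N; last by lia.
  by rewrite divnMDl ?add2n //; lia.
have tE : t = r by rewrite /t nkE mE; lia.
have lowerE : lower = r%:R * exdeg_term a q.+1 + (k - r)%:R * exdeg_term a q + p%:R * a.
  by rewrite /lower tE mE nkE /exdeg_term addSn addn2 !natrM !mulrA.
have upperE : upper = exdeg_term a p + (k%:R - 1) * exdeg_term a 0 + p%:R * a.
  by rewrite /upper nkE natrB //; lia.
split.
- move=> G hG; rewrite lowerE upperE -nkE; apply/andP; split; last exact: SEI_le.
  by apply: SEI_ge => //; rewrite nkE // ltnW.
(* The most even distribution: the first [r] rim vertices carry [q + 1] pendant vertices, the others
   [q]. *)
- pose c (i : 'I_k) := (q + (i < r))%N.
  have card_lt : #|[pred i : 'I_k | (i < r)%N]| = r.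
    rewrite -sum1_card -[RHS]card_ord -sum1_card.
    by rewrite (big_ord_widen k (fun _ => 1%N)) // ltnW.
  have sc : (\sum_i c i)%N = p.
    rewrite big_split sum_nat_const card_ord /= -big_mkcond /= sum1_card card_lt.
    by rewrite mulnC -pE.
  exists (sun c k3); split; first by have := sun_unicyclic_np c k3; rewrite sc -nE.
  rewrite SEI_sun sc lowerE; congr (_ + _).
  rewrite (bigID (fun i : 'I_k => (i < r)%N)) /=.
  rewrite (eq_bigr (fun=> exdeg_term a q.+1)) => [|i ir]; last by rewrite /c ir addn1.
  rewrite [X in _ + X](eq_bigr (fun=> exdeg_term a q)) => [|i /negPf ir]; last first.
    by rewrite /c ir addn0.
  rewrite !sumr_const card_lt !mulr_natl; congr (_ *+ _ + _ *+ _).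
  by rewrite -[k in RHS]card_ord -(cardC [pred i : 'I_k | (i < r)%N]) card_lt addKn.
- have k0 : (0 < k)%N by lia.
  (* All [p] pendant vertices hang on a single rim vertex. *)
  pose i0 := Ordinal k0; pose c (i : 'I_k) := if i == i0 then p else 0%N.
  have sc : (\sum_i c i)%N = p by rewrite -big_mkcond big_pred1_eq.
  exists (sun c k3); split; first by have := sun_unicyclic_np c k3; rewrite sc -nE.
  rewrite SEI_sun sc upperE; congr (_ + _).
  rewrite (bigD1 i0) //= {1}/c eqxx; congr (_ + _).
  rewrite (eq_bigr (fun=> exdeg_term a 0)) => [|i /negPf ni]; last by rewrite /c ni.
  rewrite sumr_const -(mulr_natl (exdeg_term a 0)); congr (_ * _).
  by rewrite cardC1 card_ord -subn1 natrB.
Qed.
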